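(* Let $a,c,d,\kappa\in\mathbb{C}$, $\mathbf e\in\mathbb{C}^r$, $\mathbf f\in\mathbb{C}^s$ with $r\le s$ be such that no displayed denominator (lower) parameter is a non-positive integer. Define $$ \begin{aligned} A&=F\!\left(\begin{matrix}c-a+\kappa,\,c+\kappa,\,c,\,d+1,\,\mathbf e+1\\ a+1,\,\kappa+1,\,c-d+\kappa,\,\mathbf f+1\end{matrix}\middle|z\right),& C&=F\!\left(\begin{matrix}c-a+\kappa,\,c+\kappa-2,\,c-1,\,d-1,\,\mathbf e\\ a-1,\,\kappa,\,c-d+\kappa,\,\mathbf f\end{matrix}\middle|z\right),\\ B&=F\!\left(\begin{matrix}c-a+\kappa+1,\,c+\kappa,\,c,\,d,\,\mathbf e+1\\ a,\,\kappa+1,\,c-d+\kappa+1,\,\mathbf f+1\end{matrix}\middle|z\right),& D&=F\!\left(\begin{matrix}c-a+\kappa-1,\,c+\kappa-2,\,c-1,\,d,\,\mathbf e\\ a,\,\kappa,\,c-d+\kappa-1,\,\mathbf f\end{matrix}\middle|z\right),\\ H&=F\!\left(\begin{matrix}c-a+\kappa,\,c+\kappa,\,c+1,\,d,\,\mathbf e+1\\ a+1,\,\kappa,\,c-d+\kappa+1,\,\mathbf f+1\end{matrix}\middle|z\right),& E&=F\!\left(\begin{matrix}c-a+\kappa,\,c+\kappa-2,\,c-1,\,d,\,\mathbf e\\ a-1,\,\kappa,\,c-d+\kappa-1,\,\mathbf f\end{matrix}\middle|z\right). \end{aligned} $$ Then the following identity holds as a formal power series in $z$, and hence wherever the displayed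 series converge: $$ \begin{aligned} &a(c-d)(\kappa-d)(\kappa+c-a)\,BD-d(c-a)(\kappa-a)(\kappa+c-d)\,AC-\kappa c(a-d)(c-a-d+\kappa)\,EH\\ &=z\,\frac{d(a-d)(c-a-d+\kappa)(c-1)(\kappa+c-a)(c+\kappa-1)(c+\kappa-2)(\mathbf e)_1}{\kappa\,(\kappa+c-d-1)\,(1-a)\,(\mathbf f)_1}\,AB. \end{aligned} $$
   Context: $F\!\left(\begin{smallmatrix}\mathbf x\\ \mathbf y\end{smallmatrix}\middle|z\right)=\sum_{k\ge0}\frac{\prod_i(x_i)_k}{\prod_i(y_i)_k}\frac{z^k}{k!}$ is the generalized hypergeometric series, $(x)_k=\Gamma(x+k)/\Gamma(x)$. Here each $F$ is of type ${}_{r+4}F_{s+3}$. $\mathbf e+1$, $\mathbf f+1$ mean adding $1$ to each component; $(\mathbf e)_1$ and $(\mathbf f)_1$ are the products of all components of $\mathbf e$ and $\mathbf f$ (empty product $=1$). *)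

(* Defs.v *)
From HB Require Import structures.
From mathcomp Require Import all_boot all_order all_algebra.
From mathcomp Require Import complex.
From mathcomp Require Import all_classical all_reals all_analysis.

Set Implicit Arguments.
Unset Strict Implicit.
Unset Printing Implicit Defensive.

Import Order.TTheory GRing.Theory Num.Theory.
Import numFieldNormedType.Exports.

Local Open Scope ring_scope.

(* The rising factorial (x)_k. It agrees with Gamma (x + k) / Gamma x wherever
   the latter is defined, and extends it to the poles of Gamma. *)
Definition pochhammer (K : fieldType) (x : K) (k : nat) : K :=
  \prod_(i < k) (x + i%:R).

(* Formal power series in z are represented by their coefficient sequences. *)
Definition fps (K : fieldType) := nat -> K.

Definition fps_mul (K : fieldType) (u v : fps K) : fps K :=
  fun n => \sum_(i < n.+1) u i * v (n - i)%N.

Definition fps_X (K : fieldType) : fps K := fun n => (n == 1%N)%:R.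
Arguments fps_X {K}.

Definition hypergeom (K : fieldType) (x y : seq K) : fps K :=
  fun k => (\prod_(u <- x) pochhammer u k) / (\prod_(v <- y) pochhammer v k)
           / k`!%:R.

(* Needed for the coefficients of [hypergeom x y] to be genuine quotients, as
   division by 0 is total. *)
Definition admissible_lower (K : fieldType) (y : seq K) : Prop :=
  forall v, v \in y -> forall m : nat, v <> - m%:R.

Definition shift1 (K : fieldType) (x : seq K) : seq K := [seq u + 1 | u <- x].

(* Stated for a numFieldType because its norm topology is found through that
   structure; at K := R[i] it is the topology of the complex modulus. Convergence
   is that of partial sums, not absolute convergence. *)
Definition fps_cvg_at (K : numFieldType) (u : fps K) (z : K) : Prop :=
  cvgn (series (fun k => u k * z ^+ k)).

Definition fps_sum_at (K : numFieldType) (u : fps K) (z : K) : K :=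
  limn (series (fun k => u k * z ^+ k)).

(* Main.v *)
(* Put p = c + kappa, q = p - a, t = p - d and g_k = (e + 1)_k / (f + 1)_k, so
   that (e)_{m+1} / (f)_{m+1} = (e)_1 / (f)_1 g_m. The coefficients of A, B, H at
   k and of C, D, E at m + 1 are rational multiples of Q_k and Q_m for a single
   hypergeometric term Q containing g. Since (a + k)(q + k) = a q + k (p + k),
   and similarly for the pairs d, t and kappa, c, the contribution of (k, m) to
   the difference of the two sides collapses to a constant multiple of
   Q_k Q_m (k (p + k) - m (p + m)), which is antisymmetric; the contribution of
   the leading coefficients 1 of C, D, E vanishes by itself. Hence each
   coefficient of the difference is 0, whatever e and f are.
   For the values at z, the Cauchy product of two convergent series is
   Cesaro-summable to the product of the sums, so no absolute convergence is
   needed, even on the boundary of the disc of convergence. *)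
Require Import Defs.
From HB Require Import structures.
From mathcomp Require Import all_boot all_order all_algebra.
From mathcomp Require Import complex ring.
From mathcomp Require Import all_classical all_reals all_analysis.

Set Implicit Arguments.
Unset Strict Implicit.
Unset Printing Implicit Defensive.

Import Order.TTheory GRing.Theory Num.Theory.
Import numFieldNormedType.Exports.

Local Open Scope ring_scope.

(** * Rising factorials and the rational identity between coefficients *)

Lemma pochhammerSr (K : fieldType) (x : K) k :
  pochhammer x k.+1 = pochhammer x k * (x + k%:R).
Proof. by rewrite /pochhammer big_ord_recr. Qed.

Lemma pochhammerSl (K : fieldType) (x : K) k :
  pochhammer x k.+1 = x * pochhammer (x + 1) k.
Proof.
rewrite /pochhammer big_ord_recl addr0; congr (_ * _).
by apply: eq_bigr => i _; rewrite /bump /= natrD addrA.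
Qed.

Lemma pochhammer0 (K : fieldType) (x : K) : pochhammer x 0 = 1.
Proof. by rewrite /pochhammer big_ord0. Qed.

Lemma pochhammer_neq0 (K : fieldType) (x : K) k :
  (forall m, x + m%:R != 0) -> pochhammer x k != 0.
Proof. by move=> hx; apply/prodf_neq0 => i _. Qed.

(** The factor contributed by [e] and [f], kept opaque in the computations; for the shifted lists it
    is g_k. *)
Definition pochhammer_ratio (K : fieldType) (x y : seq K) k : K :=
  (\prod_(u <- x) pochhammer u k) / \prod_(v <- y) pochhammer v k.

Lemma pochhammer_ratioS (K : fieldType) (x y : seq K) k :
  pochhammer_ratio x y k.+1
  = (\prod_(u <- x) u) / (\prod_(v <- y) v)
    * pochhammer_ratio (shift1 x) (shift1 y) k.
Proof.
have E (s : seq K) : \prod_(u <- s) pochhammer u k.+1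
    = (\prod_(u <- s) u) * \prod_(u <- shift1 s) pochhammer u k.
  by rewrite big_map -big_split; apply: eq_bigr => u _; rewrite pochhammerSl.
by rewrite /pochhammer_ratio !E invfM mulrACA.
Qed.

Lemma hypergeom43E (K : fieldType) (u1 u2 u3 u4 v1 v2 v3 : K) x y k :
  hypergeom [:: u1, u2, u3, u4 & x] [:: v1, v2, v3 & y] k
  = pochhammer u1 k * pochhammer u2 k * pochhammer u3 k * pochhammer u4 k
    / (pochhammer v1 k * pochhammer v2 k * pochhammer v3 k * k`!%:R)
    * pochhammer_ratio x y k.
Proof. by rewrite /hypergeom /pochhammer_ratio !big_cons !invfM; ring. Qed.

(** Both sides are the rising factorial of length k + 1; the form without division covers x = 0. *)
Lemma mul_pochhammer_succ (K : fieldType) (x : K) k :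
  x * pochhammer (x + 1) k = pochhammer x k * (x + k%:R).
Proof. by rewrite -pochhammerSl pochhammerSr. Qed.

Lemma pochhammer_succ (K : fieldType) (x : K) k : x != 0 ->
  pochhammer (x + 1) k = pochhammer x k * (x + k%:R) / x.
Proof. by move=> x0; rewrite -mul_pochhammer_succ mulrC mulKf. Qed.

Lemma pochhammer_pred (K : fieldType) (x : K) k :
  pochhammer (x - 1) k.+1 = (x - 1) * pochhammer x k.
Proof. by rewrite pochhammerSl subrK. Qed.

(* [x] and [y] stand for the parts common to the coefficients of d A, q B, c H
   at k and to those of C, D, E at m + 1; [B'] is (c - 1) (p - 1) (p - 2) times
   the coefficient of q B at m. Writing the latter through [y] avoids a division
   by p + m - 1, which may be 0. *)
Lemma coefficient_identity (K : fieldType) (a c d kap k m x y : K) :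
  a != 0 -> kap != 0 -> c - d + kap != 0 ->
  a - 1 != 0 -> 1 - a != 0 -> c - d + kap - 1 != 0 ->
  a + k != 0 -> a + m != 0 -> kap + k != 0 -> kap + m != 0 ->
  c - d + kap + k != 0 -> c - d + kap + m != 0 -> 1 + m != 0 ->
  let p := c + kap in let q := c - a + kap in let t := c - d + kap in
  let A := x * (d + k) * a / (a + k) * kap / (kap + k) in
  let B := x * (q + k) * t / (t + k) * kap / (kap + k) in
  let H := x * (c + k) * t / (t + k) * a / (a + k) in
  let C := y * (q + m) * (d - 1) / ((a - 1) * (kap + m) * (t + m) * (1 + m)) in
  let D := y * (q - 1) * (d + m) / ((a + m) * (kap + m) * (t - 1) * (1 + m)) in
  let E := y * (q + m) * (d + m) / ((a - 1) * (kap + m) * (t - 1) * (1 + m)) in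
  let B' := (p + m - 1) * y * (q + m) * t / (t + m) * kap / (kap + m) in
  a * (c - d) * (kap - d) * B * D - (c - a) * (kap - a) * t * A * C
    - kap * (a - d) * (q - d) * E * H
    - (a - d) * (q - d) / (kap * (t - 1) * (1 - a)) * A * B'
  = a * kap * t * (a - d) * (q - d) * (c - d) * (kap - d)
      / ((t - 1) * (a - 1))
    * (k * (p + k) - m * (p + m)) * x * ((p + m - 1) * y)
    / ((a + k) * (a + m) * (kap + k) * (kap + m) * (t + k) * (t + m)).
Proof.
move=> ? ? ? ? ? ? ? ? ? ? ? ? ? /=.
by field; repeat (apply/andP; split=> //).
Qed.

(** * Cauchy products of formal power series *)

Lemma fps_mulC (K : fieldType) (u v : fps K) n : fps_mul u v n = fps_mul v u n.
Proof.
rewrite /fps_mul (reindex_inj rev_ord_inj) /=; apply: eq_bigr => i _.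
by rewrite subSS subKn 1?mulrC // -ltnS.
Qed.

Lemma fps_mul_X (K : fieldType) (u : fps K) n :
  fps_mul fps_X u n = if n is m.+1 then u m else 0.
Proof.
rewrite /fps_mul /fps_X; case: n => [|n].
  by rewrite big_ord1 mul0r.
rewrite 2!big_ord_recl mul0r add0r mul1r subSS subn0 big1 ?addr0 // => i _.
by rewrite mul0r.
Qed.

Lemma fps_mul_XA (K : fieldType) (u v : fps K) n :
  fps_mul fps_X (fps_mul u v) n = fps_mul (fps_mul fps_X u) v n.
Proof.
rewrite fps_mul_X; case: n => [|n].
  by rewrite /fps_mul big_ord1 [in RHS]/fps_X big_ord1 !mul0r.
rewrite {2}/fps_mul big_ord_recl fps_mul_X mul0r add0r.
by apply: eq_bigr => i _; rewrite fps_mul_X.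
Qed.

(** * The identity of formal power series *)

Section Coefficients.
Variable K : numFieldType.
Variables (a c d kap : K) (e f : seq K).
Let p := c + kap.
Let q := c - a + kap.
Let t := c - d + kap.
Hypothesis a_neq0 : forall m, a + m%:R != 0.
Hypothesis kap_neq0 : forall m, kap + m%:R != 0.
Hypothesis t_neq0 : forall m, t + m%:R != 0.
Hypothesis a1_neq0 : a - 1 != 0.
Hypothesis t1_neq0 : t - 1 != 0.

Let A := hypergeom [:: q, c + kap, c, d + 1 & shift1 e]
  [:: a + 1, kap + 1, t & shift1 f].
Let B := hypergeom [:: q + 1, c + kap, c, d & shift1 e]
  [:: a, kap + 1, t + 1 & shift1 f].
Let C := hypergeom [:: q, c + kap - 2, c - 1, d - 1 & e]
  [:: a - 1, kap, t & f].
Let D := hypergeom [:: q - 1, c + kap - 2, c - 1, d & e]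
  [:: a, kap, t - 1 & f].
Let E := hypergeom [:: q, c + kap - 2, c - 1, d & e]
  [:: a - 1, kap, t - 1 & f].
Let H := hypergeom [:: q, c + kap, c + 1, d & shift1 e]
  [:: a + 1, kap, t + 1 & shift1 f].

Let base k := pochhammer q k * pochhammer p k * pochhammer c k * pochhammer d k
  / (pochhammer a k * pochhammer kap k * pochhammer t k * k`!%:R)
  * pochhammer_ratio (shift1 e) (shift1 f) k.
Let base' k := pochhammer q k * pochhammer (p - 2) k.+1
  * ((c - 1) * pochhammer c k) * pochhammer d k
  / (pochhammer a k * pochhammer kap k * pochhammer t k * k`!%:R)
  * pochhammer_ratio (shift1 e) (shift1 f) k.
Let w := (\prod_(u <- e) u) / (\prod_(v <- f) v).

Let an : a != 0. Proof. by have := a_neq0 0%N; rewrite addr0. Qed.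
Let kn : kap != 0. Proof. by have := kap_neq0 0%N; rewrite addr0. Qed.
Let tn : t != 0. Proof. by have := t_neq0 0%N; rewrite addr0. Qed.
Let factn k : k`!%:R != 0 :> K.
Proof. by rewrite pnatr_eq0 -lt0n fact_gt0. Qed.
Let Sn k : 1 + k%:R != 0 :> K.
Proof. by rewrite -mulrS pnatr_eq0. Qed.

Ltac nz := rewrite ?factn ?Sn ?a_neq0 ?kap_neq0 ?t_neq0 ?an ?kn ?tn
  ?pochhammer_neq0 ?a1_neq0 ?t1_neq0 //.

(** Passing from (d + 1)_k to (d)_k costs a division by d, which may be 0; the factor d on the left
    avoids it. The factors q and c do the same for [B] and [H], and the weights of the identity
    supply all three. *)
Lemma coefA k : d * A k
  = base k * (d + k%:R) * a / (a + k%:R) * kap / (kap + k%:R).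
Proof.
rewrite /A hypergeom43E /base (pochhammer_succ k an) (pochhammer_succ k kn) -/p.
have hd := mul_pochhammer_succ d k.
(* With (d + 1)_k generalized to x, [field] can use its relation to (d)_k as a hypothesis. *)
move: (pochhammer (d + 1) k) hd => x hx.
field: hx; nz.
Qed.

Lemma coefB k : q * B k
  = base k * (q + k%:R) * t / (t + k%:R) * kap / (kap + k%:R).
Proof.
rewrite /B hypergeom43E /base (pochhammer_succ k tn) (pochhammer_succ k kn) -/p.
have hq := mul_pochhammer_succ q k.
move: (pochhammer (q + 1) k) hq => x hx.
field: hx; nz.
Qed.

Lemma coefH k : c * H k
  = base k * (c + k%:R) * t / (t + k%:R) * a / (a + k%:R).
Proof.
rewrite /H hypergeom43E /base (pochhammer_succ k tn) (pochhammer_succ k an) -/p.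
have hc := mul_pochhammer_succ c k.
move: (pochhammer (c + 1) k) hc => x hx.
field: hx; nz.
Qed.

Lemma coefC m : C m.+1 = w * (base' m * (q + m%:R) * (d - 1)
  / ((a - 1) * (kap + m%:R) * (t + m%:R) * (1 + m%:R))).
Proof.
rewrite /C hypergeom43E /base' pochhammer_ratioS -/w !pochhammer_pred.
rewrite !pochhammerSr factS natrM mulrS -/p.
move: (pochhammer (p - 2) m) => x.
field; nz.
Qed.

Lemma coefD m : D m.+1 = w * (base' m * (q - 1) * (d + m%:R)
  / ((a + m%:R) * (kap + m%:R) * (t - 1) * (1 + m%:R))).
Proof.
rewrite /D hypergeom43E /base' pochhammer_ratioS -/w !pochhammer_pred.
rewrite !pochhammerSr factS natrM mulrS -/p.
field; nz.
Qed.

Lemma coefE m : E m.+1 = w * (base' m * (q + m%:R) * (d + m%:R)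
  / ((a - 1) * (kap + m%:R) * (t - 1) * (1 + m%:R))).
Proof.
rewrite /E hypergeom43E /base' pochhammer_ratioS -/w !pochhammer_pred.
rewrite !pochhammerSr factS natrM mulrS -/p.
field; nz.
Qed.

(** The rising factorial of p - 2 of length m + 2 is split once before its last factor and once
    after its first two. *)
Lemma base'E m :
  (p + m%:R - 1) * base' m = (c - 1) * (p - 1) * (p - 2) * base m.
Proof.
have hp : pochhammer (p - 2) m.+1 * (p + m%:R - 1)
    = (p - 2) * (p - 1) * pochhammer p m.
  have := pochhammerSr (p - 2) m.+1; rewrite pochhammerSl.
  have -> : p - 2 + 1 = p - 1 by ring.
  by rewrite pochhammer_pred mulrA => ->; rewrite -natr1; ring.
rewrite /base' /base; move: (pochhammer (p - 2) m.+1) hp => x hp.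
transitivity ((x * (p + m%:R - 1)) * (pochhammer q m * ((c - 1) * pochhammer c m)
  * pochhammer d m
  / (pochhammer a m * pochhammer kap m * pochhammer t m * m`!%:R)
  * pochhammer_ratio (shift1 e) (shift1 f) m)); first by ring.
by rewrite hp; ring.
Qed.

Let wBD := a * (c - d) * (kap - d) * (kap + c - a).
Let wAC := d * (c - a) * (kap - a) * (kap + c - d).
Let wEH := kap * c * (a - d) * (c - a - d + kap).
Let wAB :=
  (d * (a - d) * (c - a - d + kap) * (c - 1) * (kap + c - a)
     * (c + kap - 1) * (c + kap - 2) * \prod_(x <- e) x)
  / (kap * (kap + c - d - 1) * (1 - a) * \prod_(y <- f) y).

(** Up to the constant 1 / (a kap t), this is g_k times the coefficient with upper parameters q, p,
    c, d and lower parameters a + 1, kap + 1, t + 1. *)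
Let Q k := base k / ((a + k%:R) * (kap + k%:R) * (t + k%:R)).

(** All four products belong to degree k + m + 1, the last one through the factor z. Exchanging k
    and m changes the sign of the right-hand side. *)
Lemma term_identity k m :
  wBD * (B k * D m.+1) - wAC * (A k * C m.+1) - wEH * (E m.+1 * H k)
    - wAB * (A k * B m)
  = w * a * kap * t * (a - d) * (q - d) * (c - d) * (kap - d)
      * ((c - 1) * (p - 1) * (p - 2)) / ((t - 1) * (a - 1))
    * (k%:R * (p + k%:R) - m%:R * (p + m%:R)) * (Q k * Q m).
Proof.
have h1a : 1 - a != 0 by rewrite -opprB oppr_eq0.
have := @coefficient_identity K a c d kap k%:R m%:R (base k) (base' m)
  an kn tn a1_neq0 h1a t1_neq0
  (a_neq0 k) (a_neq0 m) (kap_neq0 k) (kap_neq0 m) (t_neq0 k) (t_neq0 m) (Sn m).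
rewrite /= -/p -/q -/t => hkm.
have wABE : wAB = (a - d) * (q - d) / (kap * (t - 1) * (1 - a)) * w
   * (d * q * ((c - 1) * (p - 1) * (p - 2))).
  rewrite /wAB /w (_ : kap + c - d - 1 = t - 1); last by rewrite /t; ring.
  by rewrite /p /q !invfM; ring.
(* The factors d, q, c of the weights move next to [A], [B], [H], as [coefA], [coefB] and [coefH]
   require. *)
transitivity (a * (c - d) * (kap - d) * (q * B k) * D m.+1
  - (c - a) * (kap - a) * t * (d * A k) * C m.+1
  - kap * (a - d) * (q - d) * E m.+1 * (c * H k)
  - (a - d) * (q - d) / (kap * (t - 1) * (1 - a)) * w * (d * A k)
    * ((c - 1) * (p - 1) * (p - 2) * (q * B m))).
  by rewrite wABE /wBD /wAC /wEH /q /t; ring.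
rewrite !coefA !coefB coefH coefC coefD coefE.
transitivity (w * (a * kap * t * (a - d) * (q - d) * (c - d) * (kap - d)
 / ((t - 1) * (a - 1)) * (k%:R * (p + k%:R) - m%:R * (p + m%:R)) * base k
  * ((p + m%:R - 1) * base' m) /
    ((a + k%:R) * (a + m%:R) * (kap + k%:R) * (kap + m%:R)
      * (t + k%:R) * (t + m%:R)))).
  by rewrite -hkm base'E; ring.
by rewrite base'E /Q !invfM; ring.
Qed.

(** These are the terms of degree n that involve the constant coefficient 1 of [D], [C], [E]. Up to
    the factor [base n], the claim is a rational identity in n. *)
Lemma boundary_identity n : wBD * B n - wAC * A n - wEH * H n = 0.
Proof.
transitivity (a * (c - d) * (kap - d) * (q * B n)
  - (c - a) * (kap - a) * t * (d * A n)
  - kap * (a - d) * (q - d) * (c * H n)).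
  by rewrite /wBD /wAC /wEH /q /t; ring.
rewrite coefA coefB coefH.
have := a_neq0 n; have := kap_neq0 n; have := t_neq0 n.
rewrite /t /q => tk kk ak; field.
by rewrite tk kk ak.
Qed.

Lemma hypergeom_formal_identity n :
  wBD * fps_mul B D n - wAC * fps_mul A C n - wEH * fps_mul E H n
  = wAB * fps_mul fps_X (fps_mul A B) n.
Proof.
(* The summand with the constant coefficient of [D], [C] or [E] is split off; commuting [E] and [H]
   makes it the last one there too. *)
rewrite fps_mul_X (fps_mulC E) /fps_mul big_ord_recr.
rewrite [in X in _ - X - _]big_ord_recr.
rewrite [in X in _ - _ - X]big_ord_recr /= subnn.
have hyp0 x y : hypergeom x y 0%N = 1 :> K.
  rewrite /hypergeom !big1 ?divr1 ?fact0 // => u _; exact: pochhammer0.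
have [-> -> ->] : [/\ C 0%N = 1, D 0%N = 1 & E 0%N = 1] by split; exact: hyp0.
rewrite !mulr1 !mulrDr.
suff hs : wBD * (\sum_(i < n) B i * D (n - i)%N)
  - wAC * (\sum_(i < n) A i * C (n - i)%N)
  - wEH * (\sum_(i < n) H i * E (n - i)%N)
  = wAB * (if n is m.+1 then fps_mul A B m else 0).
  by rewrite -hs -[RHS]addr0 -(boundary_identity n); ring.
case: n => [|n]; first by rewrite !big_ord0; ring.
rewrite !mulr_sumr -!sumrB; apply/eqP; rewrite -subr_eq0 -sumrB; apply/eqP.
set cst := w * a * kap * t * (a - d) * (q - d) * (c - d) * (kap - d)
  * ((c - 1) * (p - 1) * (p - 2)) / ((t - 1) * (a - 1)).
(* [F] is one half of the antisymmetric term, so the two sums below agree after the reversal of i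
   into n - i. *)
pose F i j := cst * (i%:R * (p + i%:R)) * (Q i * Q j).
transitivity (\sum_(i < n.+1) (F i (n - i)%N - F (n - i)%N i)).
  apply: eq_bigr => i _; have ile : (i <= n)%N by rewrite -ltnS.
  rewrite subSn // (mulrC (H i)) term_identity /F -/cst; ring.
rewrite sumrB (reindex_inj rev_ord_inj) /=.
apply/eqP; rewrite subr_eq0; apply/eqP; apply: eq_bigr => i _.
by rewrite subSS subKn // -ltnS.
Qed.

End Coefficients.

(** * Partial sums of Cauchy products *)

Definition partial_sum (K : fieldType) (u : fps K) : fps K :=
  fun n => \sum_(i < n.+1) u i.

Lemma partial_sumS (K : fieldType) (u : fps K) n :
  partial_sum u n.+1 = partial_sum u n + u n.+1.
Proof. by rewrite /partial_sum big_ord_recr. Qed.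

(** Taking partial sums is multiplication by 1 / (1 - z), and Cauchy products associate. *)
Lemma fps_mul_partial_suml (K : fieldType) (u v : fps K) n :
  fps_mul (partial_sum u) v n = partial_sum (fps_mul u v) n.
Proof.
elim: n => [|n IHn]; first by rewrite /partial_sum /fps_mul !big_ord1.
rewrite partial_sumS -IHn /fps_mul !(big_ord_recl n.+1).
rewrite [X in X * _ + _]/partial_sum big_ord1 addrCA; congr (_ + _).
rewrite -big_split; apply: eq_bigr => i _ /=.
by rewrite /bump add1n subSS partial_sumS mulrDl.
Qed.

Lemma fps_mul_partial_sum (K : fieldType) (u v : fps K) n :
  fps_mul (partial_sum u) (partial_sum v) n
  = partial_sum (partial_sum (fps_mul u v)) n.
Proof.
rewrite fps_mul_partial_suml; apply: eq_bigr => i _.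
rewrite fps_mulC fps_mul_partial_suml; apply: eq_bigr => j _.
exact: fps_mulC.
Qed.

(** * Cesaro's theorem on products, and the values of the series *)

Section CesaroMeans.
Local Open Scope classical_set_scope.

Definition cesaro_mean (K : fieldType) (u : fps K) : fps K :=
  fun n => n.+1%:R^-1 * partial_sum u n.

(* Can fail when [K] is not archimedean. It is a hypothesis of the lemmas below,
   rather than stated for [R[i]], so that they take their topology from the
   numFieldType structure, as the definitions of convergence do. *)
Definition cesaro_null (K : numFieldType) : Prop :=
  forall u : nat -> K, u @ \oo --> 0 ->
    cesaro_mean (fun n => `|u n|) @ \oo --> 0.

Lemma cesaro_null_complex (R : realType) : cesaro_null R[i].
Proof.
move=> u /cvgr0Pnorm_lt u0; apply/cvgr0Pnorm_lt => e e0.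
(* The norm and the bound e live in [R[i]] but are real; both are moved to [R], where [cesaro]
   applies. *)
have normE (x : R[i]) : `|x| = (Normc.normc x)%:C%C by [].
have norm_ge0 (x : R[i]) : 0 <= Normc.normc x.
  by rewrite -lecR -normE normr_ge0.
have eR : (complex.Re e)%:C%C = e by apply/RRe_real/gtr0_real.
have e0' : 0 < complex.Re e by rewrite -ltcR eR.
have /cesaro/cvgr0Pnorm_lt/(_ _ e0') : (fun n => Normc.normc (u n)) @ \oo --> 0.
  apply/cvgr0Pnorm_lt => r r0.
  have r0' : 0 < r%:C%C by rewrite ltcR.
  move: (u0 _ r0'); apply: filterS => n.
  by rewrite normE ltcR ger0_norm.
apply: filterS => n.
set m := arithmetic_mean _ n.
have m0 : 0 <= m.
  by rewrite mulr_ge0 ?invr_ge0 // seriesEord sumr_ge0.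
have -> : cesaro_mean (fun n => `|u n|) n = m%:C%C.
  by rewrite rmorphM fmorphV rmorph_nat seriesEord rmorph_sum.
by rewrite !ger0_norm ?lecR // -ltcR eR.
Qed.

Lemma cvg_cesaro_mean_mul (K : numFieldType) (u v : fps K) (lu lv : K) :
  cesaro_null K -> u @ \oo --> lu -> v @ \oo --> lv ->
  (fun n => n.+1%:R^-1 * fps_mul u v n) @ \oo --> lu * lv.
Proof.
move=> hK hu hv.
(* If M bounds |y|, the mean of the convolution is at most M times the Cesaro mean of |x|. *)
have null (x y : fps K) : x @ \oo --> 0 -> cvgn y ->
    (fun n => n.+1%:R^-1 * fps_mul x y n) @ \oo --> 0.
  move=> x0 /cvg_seq_bounded/pinfty_ex_gt0[M M0 yM].
  apply/cvgr0Pnorm_lt => e e0; have eM0 : 0 < e / M by rewrite divr_gt0.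
  move: (hK _ x0) => /cvgr0Pnorm_lt/(_ _ eM0); apply: filterS => n.
  rewrite ger0_norm; last by rewrite mulr_ge0 ?invr_ge0 // sumr_ge0.
  rewrite ltr_pdivlMr //; apply: le_lt_trans.
  rewrite normrM ger0_norm ?invr_ge0 // -mulrA ler_wpM2l ?invr_ge0 //.
  rewrite mulr_suml; apply: (le_trans (ler_norm_sum _ _ _)).
  by apply: ler_sum => i _; rewrite normrM ler_wpM2l //; exact: yM.
have sub0 (x : fps K) l : x @ \oo --> l -> (fun n => x n - l) @ \oo --> 0.
  by move=> hx; rewrite -(subrr l); apply: cvgB => //; exact: cvg_cst.
(* Subtracting the limits leaves two convolutions of a null sequence with a bounded one, [v] or the
   constant 1. *)
have -> : (fun n => n.+1%:R^-1 * fps_mul u v n)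
  = (fun n => n.+1%:R^-1 * fps_mul (fun i => u i - lu) v n
     + (lu * (n.+1%:R^-1 * fps_mul (fun i => v i - lv) (fun=> 1) n) + lu * lv)).
  apply/funext => n; rewrite (fps_mulC _ (fun=> 1)).
  have -> : fps_mul u v n = fps_mul (fun i => u i - lu) v n
      + (lu * fps_mul (fun=> 1) (fun i => v i - lv) n + n.+1%:R * (lu * lv)).
    have -> : n.+1%:R * (lu * lv) = \sum_(i < n.+1) lu * lv.
      by rewrite sumr_const card_ord mulr_natl.
    rewrite /fps_mul mulr_sumr -!big_split.
    by apply: eq_bigr => i _ /=; ring.
  by field; rewrite nat1r pnatr_eq0.
have cu : cvgn v by apply/cvg_ex; exists lv.
have c1 : cvgn (fun=> 1 : K) by apply/cvg_ex; exists 1; exact: cvg_cst.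
have := cvgD (null _ _ (sub0 _ _ hu) cu)
  (cvgD (cvgM (cvg_cst lu) (null _ _ (sub0 _ _ hv) c1)) (cvg_cst (lu * lv))).
by rewrite mulr0 !add0r; apply.
Qed.

(** [series] at n stops before index n while [partial_sum] includes it, hence a shift by one. *)
Lemma fps_cvg_partial_sum (K : numFieldType) (u : fps K) (z : K) :
  fps_cvg_at u z ->
  partial_sum (fun n => u n * z ^+ n) @ \oo --> fps_sum_at u z.
Proof.
rewrite /fps_cvg_at /fps_sum_at seriesEord => hu.
by move: (hu); rewrite -cvg_shiftS.
Qed.

(** By [fps_mul_partial_sum], summing the product series twice gives the convolution of the partial
    sums of its factors. *)
Lemma cvg_cesaro_mean_fps_mul (K : numFieldType) (u v : fps K) (z lu lv : K) :
  cesaro_null K ->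
  partial_sum (fun n => u n * z ^+ n) @ \oo --> lu ->
  partial_sum (fun n => v n * z ^+ n) @ \oo --> lv ->
  cesaro_mean (partial_sum (fun n => fps_mul u v n * z ^+ n)) @ \oo --> lu * lv.
Proof.
move=> hK hu hv; have := cvg_cesaro_mean_mul hK hu hv.
set F := (X in X @ \oo --> _); suff <- : F = cesaro_mean
  (partial_sum (fun n => fps_mul u v n * z ^+ n)) by [].
apply/funext => n; congr (_ * _).
rewrite fps_mul_partial_sum; do 2 (apply: eq_bigr => ? _).
rewrite /fps_mul mulr_suml; apply: eq_bigr => i _.
by rewrite mulrACA -exprD subnKC // -ltnS.
Qed.

Lemma partial_sum_X (K : numFieldType) (u : fps K) (z l : K) :
  partial_sum (fun n => u n * z ^+ n) @ \oo --> l ->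
  partial_sum (fun n => fps_mul fps_X u n * z ^+ n) @ \oo --> z * l.
Proof.
move=> hu; rewrite -(cvg_shiftS _).
have -> : (fun n => partial_sum (fun n => fps_mul fps_X u n * z ^+ n) n.+1)
  = (fun n => z * partial_sum (fun n => u n * z ^+ n) n).
  apply/funext => n; rewrite /partial_sum big_ord_recl fps_mul_X mul0r add0r.
  rewrite mulr_sumr; apply: eq_bigr => i _.
  by rewrite fps_mul_X /bump /= exprS mulrCA.
exact: cvgM (cvg_cst z) hu.
Qed.

Lemma partial_sum_relation (K : fieldType) (w1 w2 w3 w4 : K)
    (u1 u2 u3 u4 : fps K) :
  (forall n, w1 * u1 n - w2 * u2 n - w3 * u3 n = w4 * u4 n) ->
  forall n, w1 * partial_sum u1 n - w2 * partial_sum u2 n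
    - w3 * partial_sum u3 n = w4 * partial_sum u4 n.
Proof.
move=> rel n; rewrite /partial_sum !mulr_sumr -!sumrB.
by apply: eq_bigr => i _.
Qed.

(** The product series may diverge, so the relation is transferred to their Cesaro means, which do
    converge; limits are unique. *)
Lemma fps_sum_relation (K : numFieldType) (w1 w2 w3 w4 : K)
    (A B C D E H : fps K) (z : K) :
  cesaro_null K ->
  (forall n, w1 * fps_mul B D n - w2 * fps_mul A C n - w3 * fps_mul E H n
    = w4 * fps_mul fps_X (fps_mul A B) n) ->
  fps_cvg_at A z -> fps_cvg_at B z -> fps_cvg_at C z ->
  fps_cvg_at D z -> fps_cvg_at E z -> fps_cvg_at H z ->
  w1 * (fps_sum_at B z * fps_sum_at D z)
    - w2 * (fps_sum_at A z * fps_sum_at C z)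
    - w3 * (fps_sum_at E z * fps_sum_at H z)
  = z * w4 * (fps_sum_at A z * fps_sum_at B z).
Proof.
move=> hK rel /fps_cvg_partial_sum hA /fps_cvg_partial_sum hB.
move=> /fps_cvg_partial_sum hC /fps_cvg_partial_sum hD.
move=> /fps_cvg_partial_sum hE /fps_cvg_partial_sum hH.
(* The product z A B is read as (z A) B, so that it too is a product of two convergent series. *)
have relz n : w1 * (fps_mul B D n * z ^+ n) - w2 * (fps_mul A C n * z ^+ n)
    - w3 * (fps_mul E H n * z ^+ n)
    = w4 * (fps_mul (fps_mul fps_X A) B n * z ^+ n).
  by rewrite -fps_mul_XA !mulrA -!mulrBl rel.
(* Two summations: one for the partial sums, one for their means. *)
have relp := partial_sum_relation (partial_sum_relation relz).
have scale w (u : fps K) l :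
    u @ \oo --> l -> (fun n => w * u n) @ \oo --> w * l.
  by move=> hu; exact: (cvgM (cvg_cst w) hu).
have cBD := scale w1 _ _ (cvg_cesaro_mean_fps_mul hK hB hD).
have cAC := scale w2 _ _ (cvg_cesaro_mean_fps_mul hK hA hC).
have cEH := scale w3 _ _ (cvg_cesaro_mean_fps_mul hK hE hH).
have cAB := scale w4 _ _
  (cvg_cesaro_mean_fps_mul hK (partial_sum_X hA) hB).
rewrite (mulrC z) -mulrA (mulrA z).
have sub (u v : fps K) lu lv : u @ \oo --> lu -> v @ \oo --> lv ->
    (fun n => u n - v n) @ \oo --> lu - lv.
  by move=> hu hv; exact: (cvgB hu hv).
have cL := sub _ _ _ _ (sub _ _ _ _ cBD cAC) cEH.
rewrite -(cvg_lim _ cL) // -(cvg_lim _ cAB) //; congr (lim (_ @ \oo)).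
apply/funext => n; rewrite /cesaro_mean.
by rewrite !(mulrCA _ n.+1%:R^-1) -!mulrBr relp.
Qed.

End CesaroMeans.


Theorem theorem4p2 (R : realType) (r s : nat) (a c d kappa : R[i])
    (e : r.-tuple R[i]) (f : s.-tuple R[i]) (hrs : (r <= s)%N) :
  let lowA := [:: a + 1, kappa + 1, c - d + kappa & shift1 f] in
  let lowB := [:: a, kappa + 1, c - d + kappa + 1 & shift1 f] in
  let lowC := [:: a - 1, kappa, c - d + kappa & f] in
  let lowD := [:: a, kappa, c - d + kappa - 1 & f] in
  let lowE := [:: a - 1, kappa, c - d + kappa - 1 & f] in
  let lowH := [:: a + 1, kappa, c - d + kappa + 1 & shift1 f] in
  admissible_lower lowA -> admissible_lower lowB -> admissible_lower lowC ->
  admissible_lower lowD -> admissible_lower lowE -> admissible_lower lowH ->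
  let A := hypergeom
    [:: c - a + kappa, c + kappa, c, d + 1 & shift1 e] lowA in
  let B := hypergeom
    [:: c - a + kappa + 1, c + kappa, c, d & shift1 e] lowB in
  let C := hypergeom
    [:: c - a + kappa, c + kappa - 2, c - 1, d - 1 & e] lowC in
  let D := hypergeom
    [:: c - a + kappa - 1, c + kappa - 2, c - 1, d & e] lowD in
  let E := hypergeom
    [:: c - a + kappa, c + kappa - 2, c - 1, d & e] lowE in
  let H := hypergeom
    [:: c - a + kappa, c + kappa, c + 1, d & shift1 e] lowH in
  let wBD := a * (c - d) * (kappa - d) * (kappa + c - a) in
  let wAC := d * (c - a) * (kappa - a) * (kappa + c - d) in
  let wEH := kappa * c * (a - d) * (c - a - d + kappa) in
  let wAB :=
    (d * (a - d) * (c - a - d + kappa) * (c - 1) * (kappa + c - a)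
       * (c + kappa - 1) * (c + kappa - 2) * \prod_(x <- e) x)
    / (kappa * (kappa + c - d - 1) * (1 - a) * \prod_(y <- f) y) in
  (forall n : nat,
     wBD * fps_mul B D n - wAC * fps_mul A C n - wEH * fps_mul E H n
     = wAB * fps_mul fps_X (fps_mul A B) n)
  /\
  (forall z : R[i],
     fps_cvg_at A z -> fps_cvg_at B z -> fps_cvg_at C z ->
     fps_cvg_at D z -> fps_cvg_at E z -> fps_cvg_at H z ->
     wBD * (fps_sum_at B z * fps_sum_at D z)
       - wAC * (fps_sum_at A z * fps_sum_at C z)
       - wEH * (fps_sum_at E z * fps_sum_at H z)
     = z * wAB * (fps_sum_at A z * fps_sum_at B z)).
Proof.
move=> lowA lowB lowC lowD lowE lowH _ hB hC hD _ _ A B C D E H wBD wAC wEH wAB.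
(* Admissibility keeps every v + m away from 0; for the lower parameters a - 1 and c - d + kappa - 1
   the case m = 0 is taken. *)
have neq0 (y : seq R[i]) v : admissible_lower y -> v \in y ->
    forall m, v + m%:R != 0.
  by move=> hy vy m; apply/eqP => /eqP; rewrite addr_eq0 => /eqP; exact: hy.
have ha : forall m, a + m%:R != 0.
  by apply: (neq0 _ _ hB); rewrite /lowB !inE eqxx.
have hk : forall m, kappa + m%:R != 0.
  by apply: (neq0 _ _ hC); rewrite /lowC !inE eqxx ?orbT.
have ht : forall m, c - d + kappa + m%:R != 0.
  by apply: (neq0 _ _ hC); rewrite /lowC !inE eqxx ?orbT.
have ha1 : a - 1 != 0.
  by rewrite -[a - 1](addr0) (neq0 _ _ hC _ 0%N) // /lowC !inE eqxx.
have ht1 : c - d + kappa - 1 != 0.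
  by rewrite -[_ - 1](addr0) (neq0 _ _ hD _ 0%N) // /lowD !inE eqxx ?orbT.
have formal := hypergeom_formal_identity e f ha hk ht ha1 ht1.
split; first exact: formal.
move=> z; apply: fps_sum_relation; [exact: cesaro_null_complex | exact: formal].
Qed.
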